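(* Let $d$ be an odd prime power and $n$ a multiple of $d^2$. Partition the $n$ variables into $n/d^2$ disjoint piles of $d^2$ variables each, and index the variables of each pile by $\mathbb{F}_d\times\mathbb{F}_d$, where $\mathbb{F}_d$ is the finite field of order $d$. In each pile, for every $(a,b)\in\mathbb{F}_d^2$ let $S_{a,b}=\{(x,ax+b):x\in\mathbb{F}_d\}$ (a set of $d$ variables of that pile). Let $f:\{0,1\}^n\to\{0,1\}$ be any function whose $\mathrm{GF}(2)$ polynomial representation has degree $d$ and whose degree-$d$ monomials are exactly the $n$ monomials $\prod_{v\in S_{a,b}}x_v$ (over all piles and all $(a,b)\in\mathbb{F}_d^2$). Then $\|\hat f\|_0\ge 2^n-1$, regardless of the monomials of degree less than $d$.
   Context: For $h:\{0,1\}^n\to\mathbb{R}$ and $S\subseteq[n]$, $\hat h(S)=2^{-n}\sum_{x}h(x)(-1)^{\sum_{i\in S}x_i}$; $\|\hat h\|_0$ is the number of $S$ with $\hat h(S)\ne0$. *)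

(* Defs.v *)
From HB Require Import structures.
From mathcomp Require Import all_boot all_order all_algebra.
From mathcomp Require Import mpoly.

Set Implicit Arguments.
Unset Strict Implicit.
Unset Printing Implicit Defensive.

Import GRing.Theory.
Local Open Scope ring_scope.

Notation cube n := {ffun 'I_n -> bool}.

Definition fourier (R : realFieldType) (n : nat) (h : cube n -> R)
    (S : {set 'I_n}) : R :=
  (2 ^+ n)^-1 * \sum_(x : cube n) h x * (-1) ^+ (\sum_(i in S) x i)%N.

Definition fourier_sparsity (R : realFieldType) (n : nat) (h : cube n -> R) : nat :=
  #|[set S : {set 'I_n} | fourier h S != 0]|.

(* The polynomial representation over GF(2) of a Boolean function is the unique
   multilinear polynomial that agrees with it on {0,1}^n; bits are cast to 'F_2
   through the coercion from bool to nat. *)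
Definition gf2_repr (n : nat) (f : cube n -> bool) (P : {mpoly 'F_2[n]}) : Prop :=
  (forall m, m \in msupp P -> forall i, (m i <= 1)%N) /\
  (forall x : cube n, P.@[fun i => (x i)%:R] = (f x)%:R).

(* pos (k, (x, y)) is the variable of pile k with index (x, y). *)
Definition line_vars (F : finFieldType) (N n : nat)
    (pos : 'I_N * (F * F) -> 'I_n) (k : 'I_N) (a b : F) : {set 'I_n} :=
  [set pos (k, (x, a * x + b)) | x : F].

(* Main.v *)
(** Fix a nonempty [S] and let [M] be the set of monomials of [f(x) + S.x] over
    GF(2). As [d > 1], the degree-[d] monomials in [M] are still the lines.
    Expanding [(-1)^(s subset x) = 1 - 2 [s subset x]] gives
      [sum_x (-1)^(f(x) + S.x) = sum_(T subset M) (-2)^|T| 2^(n - |cover T|)].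
    Each monomial covers at most [d] variables, so every exponent
    [|T| + n - |cover T|] is at least [n / d], with equality exactly when [T]
    partitions the variables into [n / d] lines. Such a [T] is a choice of one
    parallel class in each pile, so there are [d^(n/d^2)] of them, an odd number.
    Hence the sum is an odd multiple of [2^(n/d)], in particular nonzero. For
    [S] nonempty it equals [-2^(n+1)] times the Fourier coefficient of [f] at [S]. *)

Require Import Defs.
From HB Require Import structures.
From mathcomp Require Import all_boot all_order all_algebra.
From mathcomp Require Import mpoly zify ring.

Set Implicit Arguments.
Unset Strict Implicit.
Unset Printing Implicit Defensive.

Import GRing.Theory Num.Theory.
Local Open Scope ring_scope.

(** * Sign sums over a family of sets, and their 2-adic valuation *)

Lemma odd_eq_F2 (a b : nat) : a%:R = b%:R :> 'F_2 -> odd a = odd b.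
Proof.
move/(congr1 val); rewrite /= !val_Fp_nat // !modn2.
by case: (odd a) (odd b) => [] [].
Qed.

Lemma card_supsets (I : finType) (A : {set I}) :
  #|[set x : {set I} | A \subset x]| = (2 ^ (#|I| - #|A|))%N.
Proof.
have -> : [set x : {set I} | A \subset x] = @setC I @: powerset (~: A).
  apply/setP => x; rewrite inE; apply/idP/imsetP => [Ax | [y]].
    by exists (~: x); rewrite ?setCK // inE setCS.
  by rewrite inE => yA ->; rewrite -setCS setCK.
by rewrite card_imset ?card_powerset ?(cardsCs (~: A)) ?setCK //; apply: setC_inj.
Qed.

Lemma sum_sign_expansion (I : finType) (M : {set {set I}}) :
  \sum_(x : {set I}) (-1) ^+ (\sum_(s in M) (s \subset x))%N =
  \sum_(T : {set {set I}} | T \subset M)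
     (-2) ^+ #|T| * 2 ^+ (#|I| - #|cover T|) :> int.
Proof.
have expand (x : {set I}) : (-1) ^+ (\sum_(s in M) (s \subset x))%N =
    \sum_(T : {set {set I}} | T \subset M)
       (-2) ^+ #|T| * (cover T \subset x)%:R :> int.
  rewrite expr_sum big_mkcond /=.
  under eq_bigr => s _.
    (* Moving membership in [M] into the factor lets the product range over all sets, as
       [bigA_distr] needs; families [T] outside [M] then contribute 0. *)
    rewrite (_ : (if _ then _ else _) =
      (if (s \in M) && (s \subset x) then -2 else 0) + 1 :> int).
      over.
    by case: (s \in M); case: (s \subset x).
  rewrite bigA_distr [RHS]big_mkcond; apply: eq_bigr => T _ /=.
  rewrite -big_mkcond /=.
  have [TM | /subsetPn[s sT sM]] := boolP (T \subset M); last first.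
    by rewrite (bigD1 s) //= (negbTE sM) mul0r.
  have [/bigcupsP Tx | /bigcupsP Tx] := boolP (cover T \subset x).
    rewrite mulr1 -prodr_const; apply: eq_bigr => s sT.
    by rewrite (subsetP TM) // Tx.
  have [s sT sx] : exists2 s, s \in T & ~~ (s \subset x).
    apply/exists_inP; rewrite -negb_forall_in.
    by apply/negP => /forall_inP.
  by rewrite mulr0 (bigD1 s) //= (negbTE sx) andbF mul0r.
rewrite (eq_bigr _ (fun x _ => expand x)) exchange_big /=.
apply: eq_bigr => T _; rewrite -mulr_sumr -natr_sum; congr (_ * _).
rewrite -natrX -card_supsets -sum1_card big_mkcond /=.
congr (_%:R); rewrite [RHS]big_mkcond; apply: eq_bigr => x _.
by rewrite inE; case: ifP.
Qed.

Lemma sum_sign_neq0 (I : finType) (M : {set {set I}}) (d k : nat) :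
    (1 < d)%N -> #|I| = (d * k)%N -> (forall s, s \in M -> #|s| <= d)%N ->
    odd #|[set T : {set {set I}} |
             [&& T \subset M, #|T| == k & cover T == setT]]| ->
  \sum_(x : {set I}) (-1) ^+ (\sum_(s in M) (s \subset x))%N != 0 :> int.
Proof.
move=> d_gt1 cardI Md; apply: contraL => /eqP; rewrite sum_sign_expansion => sum0.
(* The exponent of 2 left in the term of [T] after division by [2 ^ k]; [bound] shows that the
   subtraction does not truncate. *)
pose e (T : {set {set I}}) := (#|T| + (#|I| - #|cover T|) - k)%N.
have bound (T : {set {set I}}) : T \subset M ->
    (k <= #|T| + (#|I| - #|cover T|))%N /\
    (e T == 0%N) = (#|T| == k) && (cover T == setT).
  move=> TM; have leC : (#|cover T| <= #|I|)%N.
    by rewrite -cardsT subset_leq_card ?subsetT.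
  have leT : (#|cover T| <= d * #|T|)%N.
    apply: leq_trans (leq_card_cover T).1 _; rewrite mulnC -sum_nat_const.
    by apply: leq_sum => s sT; apply/Md/(subsetP TM).
  have -> : (cover T == setT) = (#|I| <= #|cover T|)%N.
    by rewrite eqEcard subsetT cardsT.
  (* If [#|T| < k], then [leT] leaves an excess of at least [(d - 1) * (k - #|T|) > 0]; otherwise
     the excess is [#|T| - k] plus the number of uncovered points. *)
  rewrite /e; nia.
have: \sum_(T : {set {set I}} | T \subset M) (-1) ^+ #|T| * 2 ^+ e T = 0 :> int.
  apply/eqP; rewrite -(mulrI_eq0 _ (mulfI (expf_neq0 k (isT : 2 != 0 :> int)))).
  apply/eqP; apply: etrans sum0; rewrite mulr_sumr; apply: eq_bigr => T /bound[le_k _].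
  rewrite mulrCA -exprD subnKC // exprD mulrA -exprMn; congr (_ ^+ _ * _).
(* Modulo 2 the signs become 1 and only terms with [e T = 0] survive, so the sum is the parity of
   the number of exact partitions. *)
move/(congr1 (intr : int -> 'F_2)); rewrite rmorph_sum /= => sumF.
rewrite (@odd_eq_F2 _ 0) //; apply: etrans sumF.
rewrite -sum1_card natr_sum /=.
rewrite big_mkcond [RHS]big_mkcond; apply: eq_bigr => T _; rewrite inE.
case: (boolP (T \subset M)) => //= /bound[_ <-]; rewrite rmorphM !rmorphXn /=.
have -> : (-1)%:~R = 1 :> 'F_2 by apply: val_inj.
have -> : 2%:~R = 0 :> 'F_2 by apply: val_inj.
by rewrite expr1n mul1r expr0n; case: (e T == 0%N).
Qed.

(** * Lines in the piles and partitions into lines *)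

Lemma mem_line_vars (F : finFieldType) (N n : nat)
    (pos : 'I_N * (F * F) -> 'I_n) (pos_inj : injective pos) (k k' : 'I_N) (a b x y : F) :
  (pos (k', (x, y)) \in line_vars pos k a b) = (k' == k) && (y == a * x + b).
Proof.
apply/imsetP/andP => [[z _ /pos_inj[-> -> ->]] // | [/eqP-> /eqP->]].
by exists x.
Qed.

(** The point with abscissa 0 determines the pile and the intercept; the point with abscissa 1 then
    determines the slope. *)
Lemma line_vars_inj (F : finFieldType) (N n : nat)
    (pos : 'I_N * (F * F) -> 'I_n) (pos_inj : injective pos) (k k' : 'I_N) (a b a' b' : F) :
  line_vars pos k a b = line_vars pos k' a' b' -> [/\ k = k', a = a' & b = b'].
Proof.
move=> eq_line.
have := mem_line_vars pos_inj k k a b 0 b.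
rewrite eq_line mem_line_vars // !mulr0 !add0r !eqxx.
case/andP=> /eqP eq_k /eqP eq_b.
have := mem_line_vars pos_inj k k a b 1 (a + b).
by rewrite eq_line mem_line_vars // !mulr1 eqxx eq_b (inj_eq (addIr _)) eqxx => /andP[_ /eqP].
Qed.

Lemma card_line_vars (F : finFieldType) (N n : nat)
    (pos : 'I_N * (F * F) -> 'I_n) (pos_inj : injective pos) (k : 'I_N) (a b : F) :
  #|line_vars pos k a b| = #|F|.
Proof. by rewrite card_imset // => x y /pos_inj[]. Qed.

Definition lines (F : finFieldType) (N n : nat) (pos : 'I_N * (F * F) -> 'I_n) :
    {set {set 'I_n}} :=
  [set line_vars pos q.1 q.2.1 q.2.2 | q : 'I_N * (F * F)].

(** The function [a] selects one parallel class in each pile through its slope. *)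
Definition parallel_partition (F : finFieldType) (N n : nat)
    (pos : 'I_N * (F * F) -> 'I_n) (a : {ffun 'I_N -> F}) : {set {set 'I_n}} :=
  [set line_vars pos q.1 (a q.1) q.2 | q : 'I_N * F].

(* Two non-vertical lines of one pile are disjoint only if they are parallel. *)
Lemma line_partitionP (F : finFieldType) (N n : nat)
    (pos : 'I_N * (F * F) -> 'I_n) (pos_bij : bijective pos) (T : {set {set 'I_n}}) :
  reflect (exists a, T = parallel_partition pos a)
    [&& T \subset lines pos, #|T| == (#|F| * N)%N & cover T == setT].
Proof.
have pos_inj := bij_inj pos_bij.
have cardn : #|'I_n| = (N * (#|F| * #|F|))%N.
  by rewrite -(bij_eq_card pos_bij) !card_prod card_ord.
apply: (iffP and3P) => [[TL /eqP cardT /eqP coverT] | [a ->]]; last first.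
  split.
  - apply/subsetP => _ /imsetP[[k b] _ ->].
    by apply/imsetP; exists (k, (a k, b)).
  - rewrite card_imset ?card_prod ?card_ord ?[(N * _)%N]mulnC //.
    by move=> [k b] [k' b'] /line_vars_inj /= [] // -> _ ->.
  - have [pos' pos'K posK] := pos_bij.
    apply/eqP/setP => i; rewrite inE -(posK i); case: (pos' i) => k [x y].
    apply/bigcupP; exists (line_vars pos k (a k) (y - a k * x)).
      by apply/imsetP; exists (k, y - a k * x).
    by rewrite mem_line_vars // addrC subrK !eqxx.
(* The sizes of the members add up to the number of variables, so a cover by them has no
   overlaps. *)
have trivT : trivIset T.
  rewrite -(eq_leqif (leq_card_cover T)) coverT cardsT cardn.
  rewrite (eq_bigr (fun=> #|F|)) ?sum_nat_const ?cardT; first by apply/eqP; ring.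
  by move=> s /(subsetP TL)/imsetP[q _ ->]; apply: card_line_vars.
have through (k : 'I_N) (x y : F) : exists a b,
    line_vars pos k a b \in T /\ y = a * x + b.
  have: pos (k, (x, y)) \in cover T by rewrite coverT inE.
  case/bigcupP => s sT; have /imsetP[[k' [a b]] _ s_eq] := subsetP TL s sT.
  rewrite s_eq mem_line_vars //= => /andP[/eqP-> /eqP->].
  by exists a, b; rewrite s_eq in sT.
have same_slope (k : 'I_N) (a b a' b' : F) :
    line_vars pos k a b \in T -> line_vars pos k a' b' \in T -> a = a'.
  move=> lT l'T; apply/eqP; apply: contraT => neq_a.
  have neq_a0 : a - a' != 0 by rewrite subr_eq0.
  (* The abscissa at which two lines of distinct slopes meet; disjointness then forces the two lines
     to coincide. *)
  pose x := (b' - b) / (a - a').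
  have lx : pos (k, (x, a * x + b)) \in line_vars pos k a b.
    by rewrite mem_line_vars // !eqxx.
  have l'x : pos (k, (x, a * x + b)) \in line_vars pos k a' b'.
    by rewrite mem_line_vars // eqxx /=; apply/eqP; rewrite /x; field.
  have := def_pblock trivT lT lx; rewrite (def_pblock trivT l'T l'x).
  by case/line_vars_inj => // _ eq_a _; rewrite eq_a eqxx in neq_a.
have slope_ex (k : 'I_N) : exists a, [exists b, line_vars pos k a b \in T].
  by have [a [b [lT _]]] := through k 0 0; exists a; apply/existsP; exists b.
exists [ffun k => xchoose (slope_ex k)].
apply/setP => s; apply/idP/imsetP => [sT | [[k b] _ ->]] /=.
  have /imsetP[[k [a b]] _ s_eq] := subsetP TL s sT; exists (k, b) => //=.
  have /existsP[b0 l0] := xchooseP (slope_ex k).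
  by rewrite s_eq in sT *; rewrite ffunE (same_slope _ _ _ _ _ sT l0).
(* The member of [T] through [(0, b)] has intercept [b] and, by [same_slope], the chosen slope. *)
rewrite ffunE; have /existsP[b0 l0] := xchooseP (slope_ex k).
have [a' [b' [l' ]]] := through k 0 b; rewrite mulr0 add0r => ->.
by rewrite (same_slope _ _ _ _ _ l0 l').
Qed.

(** Partitions correspond bijectively to slope functions: the line of intercept 0 in pile [k]
    recovers [a k]. *)
Lemma card_line_partitions (F : finFieldType) (N n : nat)
    (pos : 'I_N * (F * F) -> 'I_n) (pos_bij : bijective pos) :
  #|[set T : {set {set 'I_n}} |
       [&& T \subset lines pos, #|T| == (#|F| * N)%N & cover T == setT]]| = (#|F| ^ N)%N.
Proof.
have pos_inj := bij_inj pos_bij.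
rewrite -[N in RHS]card_ord -card_ffun -(card_imset _ (f := parallel_partition pos)).
  apply: eq_card => T; rewrite inE; apply/line_partitionP/imsetP => //.
    by case=> a ->; exists a.
  by case=> a _ ->; exists a.
move=> a a' eqT; apply/ffunP => k.
have: line_vars pos k (a k) 0 \in parallel_partition pos a'.
  by rewrite -eqT; apply/imsetP; exists (k, 0).
by case/imsetP=> [[k' b]] _ /line_vars_inj /= [] // ->.
Qed.

(** * Monomials of the GF(2) representation *)

Definition monomial_sets (n : nat) (P : {mpoly 'F_2[n]}) : {set {set 'I_n}} :=
  [set s | mesym1 s \in msupp P].

(** Nonzero coefficients in ['F_2] equal 1, and a squarefree monomial evaluates to 1 exactly when
    its variables lie in the support of [x]. *)
Lemma gf2_repr_parity (n : nat) (f : cube n -> bool) (P : {mpoly 'F_2[n]}) :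
    gf2_repr f P ->
  forall x, f x = odd (\sum_(s in monomial_sets P) (s \subset [set i | x i]))%N.
Proof.
move=> [sqfree evalP] x; rewrite -[f x]oddb; apply: odd_eq_F2.
rewrite -evalP mevalE natr_sum.
have supp_eq : perm_eq (msupp P) [seq mesym1 s | s <- enum (monomial_sets P)].
  apply: uniq_perm; rewrite ?msupp_uniq ?(map_inj_uniq (@inj_mesym1 n)) ?enum_uniq //.
  move=> m; apply/idP/mapP => [mP | [s]]; last by rewrite mem_enum inE => ? ->.
  have m_eq : m = mesym1 [set i | m i != 0%N].
    by apply/mnmP => i; rewrite mnmE inE; case: (m i) (sqfree m mP i) => [|[]].
  by exists [set i | m i != 0%N] => //; rewrite mem_enum inE -m_eq.
rewrite (perm_big _ supp_eq) big_map big_enum; apply: eq_bigr => s; rewrite inE => sP.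
have -> : P@_(mesym1 s) = 1.
  move: sP; rewrite mcoeff_msupp; move: (P@_ _) => c c_neq0.
  by apply: val_inj; case: c c_neq0 => [[|[|]]].
rewrite mul1r; have [/subsetP sx | /subsetPn[i si]] := boolP (s \subset _).
  apply: big1 => i _; rewrite mnmE; have [/sx | _] := boolP (i \in s); last by rewrite expr0.
  by rewrite inE => ->.
by rewrite inE (bigD1 i) //= mnmE si => /negbTE ->; rewrite mul0r.
Qed.

(** * Characters and Fourier coefficients *)

(** Indices common to [A] and [B] contribute a square of a sign. This mirrors the cancellation of
    equal monomials when polynomials over GF(2) are added. *)
Lemma signr_sum_symdiff (R : comNzRingType) (I : finType) (A B : {set I}) (c : I -> nat) :
  (-1) ^+ (\sum_(s in A) c s)%N * (-1) ^+ (\sum_(s in B) c s)%N =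
  (-1) ^+ (\sum_(s in (A :\: B) :|: (B :\: A)) c s)%N :> R.
Proof.
rewrite !expr_sum ![\prod_(s in _) _]big_mkcond -big_split; apply: eq_bigr => s _ /=.
rewrite !inE; case: (s \in A); case: (s \in B); rewrite /= ?mul1r ?mulr1 //.
by rewrite -expr2 sqrr_sign.
Qed.

(** Flipping a coordinate in [S] negates every term. *)
Lemma sum_character (R : numDomainType) (n : nat) (S : {set 'I_n}) :
  S != set0 -> \sum_(x : cube n) (-1) ^+ (\sum_(i in S) x i)%N = 0 :> R.
Proof.
case/set0Pn => j jS.
pose flip (x : cube n) : cube n := [ffun i => (i == j) (+) x i].
have flipK : involutive flip by move=> x; apply/ffunP => i; rewrite !ffunE addbA addbb.
set sum := LHS; have: sum = - sum.
  rewrite {1}/sum (reindex_inj (inv_inj flipK)) -sumrN; apply: eq_bigr => x _.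
  rewrite (bigD1 j) //= [in RHS](bigD1 j) //= !exprD ffunE eqxx -mulNr; congr (_ * _).
    by case: (x j); rewrite /= ?opprK.
  by congr (_ ^+ _); apply: eq_bigr => i /andP[_ /negbTE neq]; rewrite ffunE neq.
by move/eqP; rewrite -addr_eq0 -mulr2n mulrn_eq0 => /eqP.
Qed.

(** Write [(-1) ^ b = 1 - 2 b] for a bit [b]; the constant part sums to 0 by [sum_character]. The
    sign sum stays in [int], where parity makes sense. *)
Lemma fourier_neq0 (R : realFieldType) (n : nat) (f : cube n -> bool) (S : {set 'I_n}) :
    S != set0 ->
    \sum_(x : cube n) (-1) ^+ f x * (-1) ^+ (\sum_(i in S) x i)%N != 0 :> int ->
  fourier (fun x => (f x)%:R : R) S != 0.
Proof.
move=> S_neq0; apply: contra; rewrite mulf_eq0 invr_eq0 expf_eq0 pnatr_eq0 andbF /= => /eqP sum0.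
rewrite -(intr_eq0 R) rmorph_sum /=.
rewrite (eq_bigr (fun x : cube n => (-1) ^+ (\sum_(i in S) x i)%N -
    2 * ((f x)%:R * (-1) ^+ (\sum_(i in S) x i)%N))).
  by rewrite big_split /= sum_character // sumrN -mulr_sumr sum0 mulr0 subr0.
move=> x _; rewrite rmorphM /= !rmorphXn /=.
by rewrite (_ : (-1)%:~R = -1 :> R) //; case: (f x) => /=; ring.
Qed.

(** * Nonvanishing at every nonempty set *)

Theorem theorem6p2 (R : realFieldType) (d p e n : nat) (F : finFieldType)
    (p_prime : prime p) (e_gt0 : (0 < e)%N) (d_eq : d = (p ^ e)%N)
    (d_odd : odd d) (card_F : #|F| = d) (dvd_n : (d ^ 2 %| n)%N)
    (pos : 'I_(n %/ d ^ 2) * (F * F) -> 'I_n) (pos_bij : bijective pos)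
    (f : cube n -> bool) (P : {mpoly 'F_2[n]}) (f_repr : gf2_repr f P)
    (* msize is the total degree plus one *)
    (deg_P : msize P = d.+1)
    (top_P : forall m : 'X_{1..n},
       (m \in msupp P /\ mdeg m = d) <->
       (exists (k : 'I_(n %/ d ^ 2)) (a b : F), m = mesym1 (line_vars pos k a b))) :
  (2 ^ n - 1 <= fourier_sparsity (fun x => (f x)%:R : R))%N.
Proof.
have pos_inj := bij_inj pos_bij.
have d_gt1 : (1 < d)%N by rewrite -card_F card_finNzRing_gt1.
have cardn : #|'I_n| = (d * (d * (n %/ d ^ 2)))%N.
  by rewrite card_ord mulnA mulnn mulnC divnK.
have -> : (2 ^ n - 1)%N = #|[set~ set0 : {set 'I_n}]|.
  by rewrite cardsC1 -cardsT -powersetT card_powerset cardsT card_ord subn1.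
apply/subset_leq_card/subsetP => S; rewrite !inE => S_neq0.
apply: fourier_neq0 => //.
(* [D] holds the monomials of the linear form [S.x], and [M] those of its sum with [P]. *)
pose D : {set {set 'I_n}} := [set [set i] | i in S].
pose M := (monomial_sets P :\: D) :|: (D :\: monomial_sets P).
have D_small (s : {set 'I_n}) : s \in D -> #|s| = 1%N by case/imsetP => i _ ->; rewrite cards1.
have P_lines (s : {set 'I_n}) : #|s| = d -> (s \in monomial_sets P) = (s \in lines pos).
  move=> card_s; rewrite inE; apply/idP/imsetP => [sP | [[k [a b]] _ ->]].
    have [] := (top_P (mesym1 s)).1; first by rewrite mdeg_mesym1.
    by move=> k [a [b /inj_mesym1 ->]]; exists (k, (a, b)).
  by apply: ((top_P _).2 _).1; exists k, a, b.
have M_le (s : {set 'I_n}) : s \in M -> (#|s| <= d)%N.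
  rewrite inE => /orP[] /setDP[].
    by rewrite inE => /msize_mdeg_lt; rewrite deg_P mdeg_mesym1.
  by move=> /D_small ->; rewrite ltnW.
have M_top (s : {set 'I_n}) : #|s| = d -> (s \in M) = (s \in lines pos).
  move=> card_s; have /negbTE sD : s \notin D.
    by apply: contraL d_gt1 => /D_small; rewrite card_s => ->.
  by rewrite !inE sD andbF orbF -P_lines // inE.
have lines_d (s : {set 'I_n}) : s \in lines pos -> #|s| = d.
  by case/imsetP => q _ ->; rewrite card_line_vars.
have partitions_top (T : {set {set 'I_n}}) : #|T| = (d * (n %/ d ^ 2))%N ->
    cover T = setT -> (T \subset M) = (T \subset lines pos).
  move=> cardT coverT; apply/subsetP/subsetP => [TM s sT | TL s sT]; last first.
    by rewrite M_top ?TL // lines_d ?TL.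
  rewrite -M_top ?TM //; apply/eqP; move: s sT; apply/forall_inP.
  (* Sets of size at most [d] whose number is [n / d] can cover all [n] variables only if each has
     size exactly [d]. *)
  have : (\sum_(s in T) #|s| == \sum_(s in T) d)%N.
    rewrite eqn_leq leq_sum => [|t /TM /M_le //].
    rewrite sum_nat_const cardT mulnC -cardn -cardsT -coverT.
    exact: (leq_card_cover T).1.
  rewrite (eq_leqif (leqif_sum (fun t tT => leqif_eq (M_le t (TM t tT))))).
  by [].
have := @sum_sign_neq0 _ M d _ d_gt1 cardn M_le.
have -> : [set T : {set {set 'I_n}} |
      [&& T \subset M, #|T| == d * (n %/ d ^ 2) & cover T == setT]]%N =
    [set T : {set {set 'I_n}} |
      [&& T \subset lines pos, #|T| == #|F| * (n %/ d ^ 2) & cover T == setT]]%N.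
  apply/setP => T; rewrite !inE card_F.
  case: eqP => [cardT | _]; last by rewrite !andbF.
  by case: eqP => [coverT | _]; rewrite ?andbF // !andbT partitions_top.
rewrite card_line_partitions // card_F oddX d_odd orbT => /(_ isT).
(* Points of the cube are identified with their supports, over which [sum_sign_neq0] sums. *)
pose supp (x : cube n) := [set i | x i].
have supp_bij : bijective supp.
  exists (fun A : {set 'I_n} => [ffun i => i \in A]).
    by move=> x; apply/ffunP => i; rewrite ffunE inE.
  by move=> A; apply/setP => i; rewrite inE ffunE.
rewrite (reindex supp) /=; last exact: onW_bij.
congr (_ != 0); apply: eq_bigr => x _.
rewrite -signr_sum_symdiff (gf2_repr_parity f_repr) signr_odd; congr (_ * _ ^+ _).
rewrite big_imset /=; last by move=> i j _ _ /set1_inj.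
by apply: eq_bigr => i _; rewrite sub1set inE.
Qed.
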